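(* Let $$a=\frac{1-q-\alpha+\gamma+\sqrt{(1-q-\alpha+\gamma)^2+4\alpha\gamma}}{2\alpha},\qquad b=\frac{1-q-\beta+\delta+\sqrt{(1-q-\beta+\delta)^2+4\beta\delta}}{2\beta},$$ $$c=\frac{1-q-\alpha+\gamma-\sqrt{(1-q-\alpha+\gamma)^2+4\alpha\gamma}}{2\alpha},\qquad d=\frac{1-q-\beta+\delta-\sqrt{(1-q-\beta+\delta)^2+4\beta\delta}}{2\beta}.$$ Then for every $n\ge 0$, $$Z_n(y;\alpha,\beta,\gamma,\delta;q)=(abcd;q)_n\Big(\frac{\alpha\beta}{1-q}\Big)^n\sum_{k=0}^n\frac{(ab,ac/y,ad;q)_k}{(abcd;q)_k}q^k\sum_{j=0}^k q^{-j^2}(a^2/y)^{-j}\frac{(1+y+q^{j}a+q^{-j}y/a)^n}{(q,q^{-2j+1}y/a^2;q)_{j}\,(q,a^2q^{1+2j}/y;q)_{k-j}}.$$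
   Context: $(x;q)_n=\prod_{k=0}^{n-1}(1-xq^k)$ and $(a_1,\dots,a_s;q)_n=\prod_{r=1}^s(a_r;q)_n$. A staircase tableau of size $n$ is a filling of the Young diagram of staircase shape $(n,n-1,\dots,1)$ (English convention: row $r$ consists of columns $1,\dots,n+1-r$; the diagonal boxes are the last boxes of the rows) in which each box is empty or labeled by one of $\alpha,\beta,\gamma,\delta$, such that: no diagonal box is empty; every box in the same row and to the left of a $\beta$ or a $\delta$ is empty; every box in the same column and above an $\alpha$ or a $\gamma$ is empty. The type of $T$ is the word in $\{\bullet,\circ\}^n$ obtained by reading the diagonal boxes from northeast to southwest, writing $\bullet$ for $\alpha$ or $\delta$ and $\circ$ for $\beta$ or $\gamma$. Each empty box is assigned $q$ or $1$ according to the nearest labeled box to its right in its row and the nearest labeled box below it in its column: it gets $1$ if it sees a $\beta$ to its right; $q$ if it sees a $\delta$ to its right; $1$ if it sees an $\alpha$ or $\gamma$ to its right and an $\alpha$ or $\delta$ below it; $q$ if it sees an $\alpha$ or $\gamma$ to its right and a $\beta$ or $\gamma$ below it. The weight $\mathrm{wt}(T)$ is the product of all labels $\alpha,\beta,\gamma,\delta$ in $T$ and all assigned $q$'s. Let $t(T)$ be the number of $\bullet$'s in the type of $T$, and $Z_n(y;\alpha,\beta,\gamma,\delta;q)=\sum_T \mathrm{wt}(T)\,y^{t(T)}$, summed over all staircase tableaux of size $n$ (the fugacity partition function). *)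

(* Defs.v *)
From HB Require Import structures.
From mathcomp Require Import all_boot all_order all_algebra.

Set Implicit Arguments.
Unset Strict Implicit.
Unset Printing Implicit Defensive.

Import GRing.Theory.
Local Open Scope ring_scope.

Definition qpoch (F : fieldType) (x q : F) (n : nat) : F :=
  \prod_(k < n) (1 - x * q ^+ k).

Definition qpochs (F : fieldType) (s : seq F) (q : F) (n : nat) : F :=
  \prod_(x <- s) qpoch x q n.

Inductive label := Alpha | Beta | Gamma | Delta.

Definition label_code (l : label) : bool * bool :=
  match l with
  | Alpha => (false, false)
  | Beta => (false, true)
  | Gamma => (true, false)
  | Delta => (true, true)
  end.

Definition label_decode (c : bool * bool) : label :=
  match c with
  | (false, false) => Alpha
  | (false, true) => Beta
  | (true, false) => Gamma
  | (true, true) => Delta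
  end.

Lemma label_codeK : cancel label_code label_decode.
Proof. by case. Qed.

HB.instance Definition _ := Finite.copy label (can_type label_codeK).

(* Rows and columns are numbered from 0, row 0 on top and column 0 on the
   left, so row r has the columns c with r + c < n. *)
Definition box (n : nat) := {x : 'I_n * 'I_n | (x.1 + x.2 < n)%N}.

Definition brow (n : nat) (b : box n) : 'I_n := (val b).1.
Definition bcol (n : nat) (b : box n) : 'I_n := (val b).2.

Lemma diag_box_subproof (n : nat) (r : 'I_n) : (r + rev_ord r < n)%N.
Proof. by rewrite /= subnS -[in ltnRHS](subnKC (ltnW (ltn_ord r))) ltn_add2l
  prednK // subn_gt0. Qed.

Definition diag_box (n : nat) (r : 'I_n) : box n :=
  exist (fun x : 'I_n * 'I_n => is_true (x.1 + x.2 < n)%N)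
    (r, rev_ord r) (diag_box_subproof r).

(* [None] is an empty box. *)
Definition filling (n : nat) := {ffun box n -> option label}.

Definition is_staircase_tableau (n : nat) (T : filling n) : bool :=
  [&& [forall r : 'I_n, T (diag_box r) != None],
      [forall b : box n, forall b' : box n,
         [&& (T b == Some Beta) || (T b == Some Delta),
             brow b' == brow b & (bcol b' < bcol b)%N] ==> (T b' == None)]
    & [forall b : box n, forall b' : box n,
         [&& (T b == Some Alpha) || (T b == Some Gamma),
             bcol b' == bcol b & (brow b' < brow b)%N] ==> (T b' == None)]].

Definition nearest_right (n : nat) (T : filling n) (b b' : box n) : bool :=
  [&& brow b' == brow b, (bcol b < bcol b')%N, T b' != None
    & [forall b'' : box n,
         [&& brow b'' == brow b, (bcol b < bcol b'')%N
           & (bcol b'' < bcol b')%N] ==> (T b'' == None)]].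

Definition nearest_below (n : nat) (T : filling n) (b b' : box n) : bool :=
  [&& bcol b' == bcol b, (brow b < brow b')%N, T b' != None
    & [forall b'' : box n,
         [&& bcol b'' == bcol b, (brow b < brow b'')%N
           & (brow b'' < brow b')%N] ==> (T b'' == None)]].

Definition label_right (n : nat) (T : filling n) (b : box n) : option label :=
  if [pick b' | nearest_right T b b'] is Some b' then T b' else None.

Definition label_below (n : nat) (T : filling n) (b : box n) : option label :=
  if [pick b' | nearest_below T b b'] is Some b' then T b' else None.

Definition label_val (F : fieldType) (alpha beta gamma delta : F) (l : label)
  : F :=
  match l with
  | Alpha => alpha
  | Beta => beta
  | Gamma => gamma
  | Delta => delta
  end.

(* In a staircase tableau an empty box always has a label to its right and one
   below it (its row and its column both end on the diagonal), so the last
   case below does not occur for the empty boxes of a tableau. *)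
Definition empty_val (F : fieldType) (q : F) (right below : option label) : F :=
  match right, below with
  | Some Beta, _ => 1
  | Some Delta, _ => q
  | Some (Alpha | Gamma), Some (Alpha | Delta) => 1
  | Some (Alpha | Gamma), Some (Beta | Gamma) => q
  | _, _ => 1
  end.

Definition wt (F : fieldType) (alpha beta gamma delta q : F) (n : nat)
    (T : filling n) : F :=
  \prod_(b : box n)
    match T b with
    | Some l => label_val alpha beta gamma delta l
    | None => empty_val q (label_right T b) (label_below T b)
    end.

(* Increasing rows read the diagonal from northeast to southwest; [true]
   stands for a bullet and [false] for a circle. *)
Definition tableau_type (n : nat) (T : filling n) : n.-tuple bool :=
  [tuple (T (diag_box r) == Some Alpha) || (T (diag_box r) == Some Delta)
     | r < n].

Definition num_bullets (n : nat) (T : filling n) : nat :=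
  count_mem true (tableau_type T).

Definition Z (F : fieldType) (n : nat) (y alpha beta gamma delta q : F) : F :=
  \sum_(T : filling n | is_staircase_tableau T)
     wt alpha beta gamma delta q T * y ^+ num_bullets T.

(* Main.v *)
From HB Require Import structures.
Require Import Defs.
From mathcomp Require Import all_boot all_order all_algebra.
From mathcomp Require Import zify ring.

Set Implicit Arguments.
Unset Strict Implicit.
Unset Printing Implicit Defensive.

Import GRing.Theory.
Local Open Scope ring_scope.

(* Remove the leftmost column of a staircase tableau.  The column only depends
   on the leftmost label of each row of the remaining tableau: a row closed by
   a beta (delta) forces an empty box of weight 1 (q), while the rows starting
   with alpha or gamma are interchangeable.  Marking the latter by x and the
   delta-rows by u, the generating polynomial satisfies
     G_(n+1)(x, u) = (y D + E) G_n(x, q u)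
   for linear operators D, E on polynomials in x determined by
     D 1 = alpha x + delta u,       D (x p) = x D p + delta u (D p + E p),
     E 1 = gamma x + beta,          E (x p) = q x E p + beta (D p + E p).
   Since 1 - q = alpha (1 + a) (1 + c) and gamma = - alpha a c, both operators
   are bidiagonal in the basis
     psi_k = prod_(i < k) alpha a q^i ((1 - q) x + delta (1 + a q^i) u
                                       - beta (1 + 1 / (a q^i))),
   and psi_k(1, 1) = (- alpha beta)^k (ab, ad; q)_k.  The matrix of
   (1 - q) (y D + E) in this basis has the numbers X_k = 1 + y + q^k a +
   q^(-k) y / a on its diagonal, up to factors alpha beta - gamma delta q^k u,
   so the coefficients of its n-th power are divided differences of X^n at the
   nodes X_0, ..., X_k; this is the inner sum of the formula. *)

(** * Removing the first column *)

Definition is_ag (o : option label) : bool :=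
  (o == Some Alpha) || (o == Some Gamma).

Definition is_bd (o : option label) : bool :=
  (o == Some Beta) || (o == Some Delta).

Fixpoint first_label (s : seq (option label)) : option label :=
  if s is o :: s' then if o is Some _ then o else first_label s' else None.

Lemma first_label_iota (g : nat -> option label) (m l : nat) :
  (exists k, [/\ (m <= k < m + l)%N, g k != None,
     forall k', (m <= k' < k)%N -> g k' = None
     & first_label [seq g i | i <- iota m l] = g k])
  \/ (forall k, (m <= k < m + l)%N -> g k = None) /\
     first_label [seq g i | i <- iota m l] = None.
Proof.
elim: l m => [|l IHl] m /=; first by right; split=> // k; lia.
case gm: (g m) => [x|].
  by left; exists m; split; rewrite ?gm //; lia.
case: (IHl m.+1) => [[k [hk gk hk' ->]]|[h ->]].
  left; exists k; split=> //; first lia.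
  move=> k' hk''; have [->//|ne] := eqVneq k' m.
  by apply: hk'; lia.
right; split=> // k hk; have [->//|ne] := eqVneq k m.
by apply: h; lia.
Qed.

Lemma first_label_rcons_None (s : seq (option label)) :
  first_label (rcons s None) = first_label s.
Proof. by elim: s => //= -[]. Qed.

(* The value is [None] outside of the staircase shape. *)
Definition lab (n : nat) (T : filling n) (i j : nat) : option label :=
  if [pick b : box n | (brow b == i :> nat) && (bcol b == j :> nat)] is Some b
  then T b else None.

Lemma box_inj (n : nat) (b b' : box n) :
  brow b = brow b' :> nat -> bcol b = bcol b' :> nat -> b = b'.
Proof.
rewrite /brow /bcol => h1 h2; apply: val_inj.
by move: h1 h2; case: (val b) (val b') => [? ?] [? ?] /= /val_inj -> /val_inj ->.
Qed.

Lemma box_ex (n i j : nat) :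
  (i + j < n)%N -> exists2 b : box n, brow b = i :> nat & bcol b = j :> nat.
Proof.
move=> h; have hi : (i < n)%N by lia. have hj : (j < n)%N by lia.
by exists (exist (fun x : 'I_n * 'I_n => is_true (x.1 + x.2 < n)%N)
  (Ordinal hi, Ordinal hj) h).
Qed.

Lemma box_lt (n : nat) (b : box n) : (brow b + bcol b < n)%N.
Proof. exact: (valP b). Qed.

Lemma labE (n : nat) (T : filling n) (b : box n) :
  lab T (brow b) (bcol b) = T b.
Proof.
rewrite /lab; case: pickP => [b' /andP[/eqP h1 /eqP h2]|/(_ b)].
  by rewrite (box_inj h1 h2).
by rewrite !eqxx.
Qed.

Lemma lab_out (n : nat) (T : filling n) (i j : nat) :
  (n <= i + j)%N -> lab T i j = None.
Proof.
move=> h; rewrite /lab; case: pickP => // b /andP[/eqP h1 /eqP h2].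
by have := box_lt b; lia.
Qed.

Lemma lab_lt (n : nat) (T : filling n) (i j : nat) :
  lab T i j != None -> (i + j < n)%N.
Proof. by case: (ltnP (i + j) n) => // /(lab_out T) ->. Qed.

Lemma lab_inj (n : nat) (T T' : filling n) :
  (forall i j, lab T i j = lab T' i j) -> T = T'.
Proof. by move=> h; apply/ffunP => b; rewrite -!labE h. Qed.

Lemma lab_diag (n : nat) (T : filling n) (r : 'I_n) :
  T (diag_box r) = lab T r (n - r.+1).
Proof. by rewrite -labE. Qed.

Lemma staircaseP (n : nat) (T : filling n) :
  reflect [/\ forall r, (r < n)%N -> lab T r (n - r.+1) != None,
    forall i j k, is_bd (lab T i j) -> (k < j)%N -> lab T i k = None
  & forall i k j, is_ag (lab T i j) -> (k < i)%N -> lab T k j = None]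
  (is_staircase_tableau T).
Proof.
apply: (iffP and3P) => [[/forallP h1 /forallP h2 /forallP h3]|[h1 h2 h3]].
  split.
  - by move=> r hr; have := h1 (Ordinal hr); rewrite lab_diag.
  - move=> i j k hbd hk.
    have hl : lab T i j != None by case: (lab T i j) hbd.
    have [b bi bj] := box_ex (lab_lt hl).
    have [b' bi' bj'] : exists2 b' : box n, brow b' = i :> nat & bcol b' = k :> nat.
      by apply: box_ex; have := lab_lt hl; lia.
    rewrite -bi -bj labE in hbd.
    have /forallP/(_ b') := h2 b; rewrite -[_ || _]/(is_bd (T b)) hbd.
    rewrite -val_eqE /= bi bi' eqxx bj bj' hk -labE bi' bj' /=.
    by move/eqP.
  - move=> i k j hag hk.
    have hl : lab T i j != None by case: (lab T i j) hag.
    have [b bi bj] := box_ex (lab_lt hl).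
    have [b' bi' bj'] : exists2 b' : box n, brow b' = k :> nat & bcol b' = j :> nat.
      by apply: box_ex; have := lab_lt hl; lia.
    rewrite -bi -bj labE in hag.
    have /forallP/(_ b') := h3 b; rewrite -[_ || _]/(is_ag (T b)) hag.
    rewrite -val_eqE /= bj bj' eqxx bi bi' hk -labE bi' bj' /=.
    by move/eqP.
split.
- by apply/forallP => r; rewrite lab_diag; apply: h1.
- apply/forallP => b; apply/forallP => b'; apply/implyP => /and3P[hb /eqP hr hc].
  by rewrite -labE hr; apply/eqP; apply: h2 hc; rewrite labE.
- apply/forallP => b; apply/forallP => b'; apply/implyP => /and3P[hb /eqP hr hc].
  by rewrite -labE hr; apply/eqP; apply: h3 hc; rewrite labE.
Qed.

(** The nearest labelled box is unique and [lab] is [None] outside the shape, so a scan of the row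
    up to [n] finds the label that [pick] selects. *)
Lemma label_rightE (n : nat) (T : filling n) (b : box n) :
  label_right T b = first_label
    [seq lab T (brow b) k | k <- iota (bcol b).+1 (n - (bcol b).+1)].
Proof.
rewrite /label_right.
case: (first_label_iota (lab T (brow b)) (bcol b).+1 (n - (bcol b).+1)).
  move=> [k [hk gk hk' ->]]; have [b1 br1 bc1] := box_ex (lab_lt gk).
  have nb1 : nearest_right T b b1.
    rewrite /nearest_right -val_eqE /= br1 eqxx bc1 -labE br1 bc1 gk.
    rewrite (_ : (bcol b < k)%N) /=; last lia.
    apply/forallP => b2; apply/implyP => /and3P[/eqP e h1 h2].
    by rewrite -labE e hk' // h1.
  case: pickP => [b2 /and4P[/eqP e h1 h2 /forallP h3]|/(_ b1)]; last by rewrite nb1.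
  rewrite -labE -br1 -bc1 e; have e1 : brow b1 = brow b by apply: val_inj.
  case/and4P: nb1 => _ h1' h2' /forallP h3'; rewrite -e1.
  case: (ltngtP (bcol b2) (bcol b1)) => [lt|lt|->//].
    by have := h3' b2; rewrite e eqxx h1 lt /= (negPf h2).
  by have := h3 b1; rewrite e1 eqxx h1' lt /= (negPf h2').
move=> [h ->]; case: pickP => // b2 /and4P[/eqP e h1 h2 _].
rewrite -labE e; apply: h; have := ltn_ord (bcol b2); lia.
Qed.

Lemma label_belowE (n : nat) (T : filling n) (b : box n) :
  label_below T b = first_label
    [seq lab T k (bcol b) | k <- iota (brow b).+1 (n - (brow b).+1)].
Proof.
rewrite /label_below.
case: (first_label_iota (lab T ^~ (bcol b)) (brow b).+1 (n - (brow b).+1)).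
  move=> [k [hk gk hk' ->]]; have [b1 br1 bc1] := box_ex (lab_lt gk).
  have nb1 : nearest_below T b b1.
    rewrite /nearest_below -val_eqE /= bc1 eqxx br1 -labE br1 bc1 gk.
    rewrite (_ : (brow b < k)%N) /=; last lia.
    apply/forallP => b2; apply/implyP => /and3P[/eqP e h1 h2].
    by rewrite -labE e hk' // h1.
  case: pickP => [b2 /and4P[/eqP e h1 h2 /forallP h3]|/(_ b1)]; last by rewrite nb1.
  rewrite -labE -br1 -bc1 e; have e1 : bcol b1 = bcol b by apply: val_inj.
  case/and4P: nb1 => _ h1' h2' /forallP h3'; rewrite -e1.
  case: (ltngtP (brow b2) (brow b1)) => [lt|lt|->//].
    by have := h3' b2; rewrite e eqxx h1 lt /= (negPf h2).
  by have := h3 b1; rewrite e1 eqxx h1' lt /= (negPf h2').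
move=> [h ->]; case: pickP => // b2 /and4P[/eqP e h1 h2 _].
rewrite -labE e; apply: h; have := ltn_ord (brow b2); lia.
Qed.

(** * Adjoining a column on the left *)

Definition add_column (n : nat) (s : seq (option label)) (T : filling n) :
    filling n.+1 :=
  [ffun b => if bcol b : nat is j.+1 then lab T (brow b) j else nth None s (brow b)].

Lemma lab_add_column0 (n : nat) (s : n.+1.-tuple (option label)) (T : filling n) i :
  lab (add_column s T) i 0 = nth None s i.
Proof.
case: (ltnP i n.+1) => hi; last first.
  by rewrite lab_out ?addn0 // nth_default ?size_tuple.
have [|b bi bj] := @box_ex n.+1 i 0; first by rewrite addn0.
by rewrite -bi -bj labE ffunE bj.
Qed.

Lemma lab_add_columnS (n : nat) (s : seq (option label)) (T : filling n) i j :
  lab (add_column s T) i j.+1 = lab T i j.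
Proof.
case: (ltnP (i + j) n) => hi; last by rewrite !lab_out //; lia.
have [|b bi bj] := @box_ex n.+1 i j.+1; first lia.
by rewrite -{1}bi -{1}bj labE ffunE bj bi.
Qed.

Lemma sum_add_column (V : nmodType) (n : nat) (Phi : filling n.+1 -> V) :
  \sum_(T : filling n.+1) Phi T =
  \sum_(T : filling n) \sum_(s : n.+1.-tuple (option label)) Phi (add_column s T).
Proof.
rewrite pair_big /= (reindex (fun p : filling n * n.+1.-tuple (option label) =>
  add_column p.2 p.1)) //=.
exists (fun T : filling n.+1 =>
  ([ffun b => lab T (brow b) (bcol b).+1], [tuple lab T i 0 | i < n.+1])).
- move=> [T s] _ /=; congr pair.
    by apply/ffunP => b; rewrite ffunE lab_add_columnS labE.
  by apply: eq_from_tnth => i; rewrite tnth_mktuple lab_add_column0 -tnth_nth.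
- move=> T _; apply: lab_inj => i [|j]; cbn [fst snd].
    rewrite lab_add_column0; case: (ltnP i n.+1) => hi.
      by rewrite -(tnth_nth _ _ (Ordinal hi)) tnth_mktuple.
    by rewrite nth_default ?size_tuple // lab_out // addn0.
  rewrite lab_add_columnS; case: (ltnP (i + j) n) => h.
    by have [b bi bj] := box_ex h; rewrite -bi -bj labE ffunE.
  by rewrite !lab_out //; lia.
Qed.

Lemma prod_box (R : comPzSemiRingType) (n : nat) (g : nat -> nat -> R) :
  \prod_(b : box n) g (brow b) (bcol b) =
  \prod_(j < n) \prod_(i < n | (i + j < n)%N) g i j.
Proof.
rewrite (exchange_big_dep xpredT) //= pair_big_dep /=.
by rewrite (@big_sub _ _ _ _ [pred x : 'I_n * 'I_n | (x.1 + x.2 < n)%N]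
  (fun x => g x.1 x.2)).
Qed.

Lemma prod_box_recl (R : comPzSemiRingType) (n : nat) (g : nat -> nat -> R) :
  \prod_(b : box n.+1) g (brow b) (bcol b) =
  (\prod_(i < n.+1) g i 0%N) * \prod_(b : box n) g (brow b) (bcol b).+1.
Proof.
rewrite !(prod_box, @prod_box R n (fun i j => g i j.+1)) big_ord_recl /=.
congr (_ * _); first by apply: eq_bigl => i; rewrite addn0 ltn_ord.
(* Row [n] has its only box in column 0, so it contributes 1 to every later column. *)
apply: eq_bigr => j _; rewrite big_mkcond big_ord_recr /= -[RHS]mulr1.
rewrite -big_mkcond /= ifF; last by rewrite /bump; lia.
by congr (_ * _); apply: eq_bigl => i; rewrite /bump; lia.
Qed.

Lemma big_tcons (V : nmodType) (A : finType) (n : nat) (P : pred (n.+1.-tuple A))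
    (Phi : n.+1.-tuple A -> V) :
  \sum_(s : n.+1.-tuple A | P s) Phi s =
  \sum_(x : A) \sum_(s : n.-tuple A | P [tuple of x :: s]) Phi [tuple of x :: s].
Proof.
rewrite pair_big_dep /= (reindex (fun p : A * n.-tuple A => [tuple of p.1 :: p.2])) //=.
exists (fun s : n.+1.-tuple A => (thead s, [tuple of behead s])).
  by move=> [x s] _; congr pair; apply: val_inj.
by move=> s _; rewrite [RHS]tuple_eta; apply: val_inj.
Qed.

Lemma sum_label (V : nmodType) (Phi : label -> V) :
  \sum_l Phi l = Phi Alpha + Phi Beta + Phi Gamma + Phi Delta.
Proof.
rewrite (bigD1 Alpha) //= (bigD1 Beta) //= (bigD1 Gamma) //= (bigD1 Delta) //=.
by rewrite big_pred0 ?addr0 ?addrA //; case.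
Qed.

Lemma sum_option (V : nmodType) (A : finType) (Phi : option A -> V) :
  \sum_o Phi o = Phi None + \sum_x Phi (Some x).
Proof.
rewrite (bigD1 None) //=; congr (_ + _).
rewrite (reindex_omap Some id) => [|[x|]] //=.
by apply: eq_bigl => x; rewrite eqxx.
Qed.

Lemma first_label_None (s : seq (option label)) i :
  first_label s = None -> nth None s i = None.
Proof. by elim: s i => [|[//|] s IHs] [|i] //= h; apply: IHs. Qed.

Lemma first_label_nth (s : seq (option label)) i :
  nth None s i != None -> (forall k, (k < i)%N -> nth None s k = None) ->
  first_label s = nth None s i.
Proof.
elim: s i => [|o s IHs] [|i] //=; first by case: o.
move=> h hk; have /= := hk 0 isT => ->.
by apply: IHs h _ => k /(hk k.+1).
Qed.

Lemma first_label_ex (s : seq (option label)) :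
  first_label s != None ->
  exists2 i, first_label s = nth None s i & nth None s i != None.
Proof.
elim: s => [//|[l|] s IHs] /=; first by exists 0.
by case/IHs => i hi hi'; exists i.+1.
Qed.

(* [st] lists the leftmost labels of the rows to the right of the new column,
   which has one more box, at its bottom. *)
Fixpoint column_ok (st s : seq (option label)) : bool :=
  match st, s with
  | o' :: st', o :: s' =>
      ((o == None) || is_ag o' && is_bd (first_label s')) && column_ok st' s'
  | [::], [:: o] => o != None
  | _, _ => false
  end.

Lemma agN_bd (o : option label) : o != None -> ~~ is_ag o -> is_bd o.
Proof. by case: o => [[]|]. Qed.

Lemma bdN_ag (o : option label) : is_bd o -> is_ag o -> False.
Proof. by case: o => [[]|]. Qed.

(** The bottom entry is nonempty, so every other entry has a first label below it. An alpha or gamma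
    further down would already forbid that first label, so the column condition need only be tested
    against the first label below. *)
Lemma column_okP (st s : seq (option label)) : size s = (size st).+1 ->
  reflect [/\ nth None s (size st) != None,
    forall i, (i < size st)%N -> ~~ is_ag (nth None st i) -> nth None s i = None
  & forall i k, is_ag (nth None s i) -> (k < i)%N -> nth None s k = None]
  (column_ok st s).
Proof.
elim: st s => [|o' st IHst] [|o s] //= [].
  case: s => //= _; apply: (iffP idP) => [h|[]//].
  by split=> // -[|i] k //=; rewrite nth_nil.
move=> hs; apply: (iffP andP).
  move=> [ho /(IHst _ hs)[h1 h2 h3]]; split=> //.
    by move=> [|i] /=; [move=> _; case: eqP ho => //= _ /andP[->] | apply: h2].
  move=> [//|i] [|k] /= hi hk; last exact: h3 hi hk.
  case: eqP ho => //= _ /andP[_].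
  by rewrite (@first_label_nth _ i) //; [move/bdN_ag/(_ hi) | case: (nth None s i) hi
    | move=> k' /h3; apply].
move=> [h1 h2 h3]; split; last first.
  apply/(IHst _ hs); split=> //; first by move=> i; apply: (h2 i.+1).
  by move=> i k; apply: (h3 i.+1 k.+1).
case: eqP => //= ho; apply/andP; split.
  by apply/negPn/negP => /(h2 0 isT).
have hf : first_label s != None.
  by apply/eqP => /(@first_label_None _ (size st)) e; rewrite e in h1.
apply: agN_bd (hf) _; apply/negP => hag; case: (first_label_ex hf) => i hi _.
by apply: ho; apply: (h3 i.+1 0) => //=; rewrite -hi.
Qed.

Definition row_lab (n : nat) (T : filling n) (i : nat) : option label :=
  first_label [seq lab T i k | k <- iota 0 n].

Definition row_labs (n : nat) (T : filling n) : seq (option label) :=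
  [seq row_lab T i | i <- iota 0 n].

Lemma size_row_labs (n : nat) (T : filling n) : size (row_labs T) = n.
Proof. by rewrite size_map size_iota. Qed.

Lemma nth_row_labs (n : nat) (T : filling n) i :
  nth None (row_labs T) i = row_lab T i.
Proof.
case: (ltnP i n) => hi; first by rewrite (nth_map 0%N) ?size_iota // nth_iota.
rewrite nth_default ?size_row_labs // /row_lab.
case: (first_label_iota (lab T i) 0 n) => [[k [_ h _ _]]|[_ ->]//].
by rewrite lab_out // in h; lia.
Qed.

Lemma row_lab_ex (n : nat) (T : filling n) i :
  is_staircase_tableau T -> (i < n)%N ->
  exists k, [/\ row_lab T i = lab T i k, lab T i k != None
    & forall k', (k' < k)%N -> lab T i k' = None].
Proof.
move=> /staircaseP[h1 _ _] hi; rewrite /row_lab.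
case: (first_label_iota (lab T i) 0 n) => [[k [_ h hk ->]]|[h _]]; first by exists k.
by have := h1 i hi; rewrite h //; lia.
Qed.

Lemma row_lab_neqNone (n : nat) (T : filling n) i :
  is_staircase_tableau T -> (i < n)%N -> row_lab T i != None.
Proof. by move=> vT hi; case: (row_lab_ex vT hi) => k [->]. Qed.

(** A beta or delta empties all boxes to its left, so it can only be the leftmost label of its row.
    Hence the leftmost labels alone decide which boxes of a new first column are forced to be
    empty. *)
Lemma row_lab_bdP (n : nat) (T : filling n) i :
  is_staircase_tableau T -> (i < n)%N ->
  reflect (exists j, is_bd (lab T i j)) (~~ is_ag (row_lab T i)).
Proof.
move=> vT hi; apply: (iffP idP).
  by case: (row_lab_ex vT hi) => k [-> h _] hag; exists k; apply: agN_bd.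
case: (row_lab_ex vT hi) => k [-> h hk] [j hj].
case/staircaseP: vT => _ h2 _; case: (ltngtP j k) => [lt|lt|<-].
- by rewrite hk in hj.
- by rewrite (h2 _ _ _ hj lt) in h.
- by apply/negP => /(bdN_ag hj).
Qed.

Lemma staircase_add_column (n : nat) (s : n.+1.-tuple (option label)) (T : filling n) :
  is_staircase_tableau (add_column s T) =
  is_staircase_tableau T && column_ok (row_labs T) s.
Proof.
have hs : size s = (size (row_labs T)).+1 by rewrite size_row_labs size_tuple.
apply/staircaseP/andP => [[h1 h2 h3]|[vT /(column_okP hs)]].
  have vT : is_staircase_tableau T.
    apply/staircaseP; split.
    - move=> r hr; have := h1 r (ltnW hr).
      by rewrite subSS (_ : n - r = (n - r.+1).+1)%N ?lab_add_columnS //; lia.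
    - by move=> i j k; have := h2 i j.+1 k.+1; rewrite !lab_add_columnS.
    - by move=> i k j; have := h3 i k j.+1; rewrite !lab_add_columnS.
  split=> //; apply/(column_okP hs); rewrite size_row_labs; split.
  - by have := h1 n (ltnSn n); rewrite subnn lab_add_column0.
  - move=> i hi; rewrite nth_row_labs; case/(row_lab_bdP vT hi) => j hj.
    by have := h2 i j.+1 0%N; rewrite lab_add_columnS lab_add_column0; apply.
  - by move=> i k; have := h3 i k 0%N; rewrite !lab_add_column0.
rewrite size_row_labs => -[h1 h2 h3]; case/staircaseP: (vT) => g1 g2 g3; split.
- move=> r; rewrite ltnS leq_eqVlt => /orP[/eqP->|hr].
    by rewrite subnn lab_add_column0.
  by rewrite subSS (_ : n - r = (n - r.+1).+1)%N ?lab_add_columnS ?g1 //; lia.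
- move=> i [//|j] [|k]; rewrite lab_add_columnS ?lab_add_columnS ?lab_add_column0.
    move=> hj _; have hi : (i < n)%N.
      by have := @lab_lt _ T i j; case: (lab T i j) hj => // ? _ /(_ isT); lia.
    by apply: h2 => //; rewrite nth_row_labs; apply/row_lab_bdP => //; exists j.
  exact: g2.
- by move=> i k [|j]; rewrite ?lab_add_columnS ?lab_add_column0; [apply: h3 | apply: g3].
Qed.

Lemma row_lab_add_column (n : nat) (s : n.+1.-tuple (option label)) (T : filling n) i :
  row_lab (add_column s T) i =
  if nth None s i is Some l then Some l else row_lab T i.
Proof.
rewrite /row_lab /= lab_add_column0; case: (nth None s i) => //.
rewrite -[1%N]addn0 iotaDl -map_comp.
by under eq_map => k do rewrite /= add1n lab_add_columnS.
Qed.

Definition cell_val (F : fieldType) (alpha beta gamma delta q : F) (n : nat)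
    (T : filling n) (i j : nat) : F :=
  if lab T i j is Some l then label_val alpha beta gamma delta l
  else empty_val q (first_label [seq lab T i k | k <- iota j.+1 (n - j.+1)])
                   (first_label [seq lab T k j | k <- iota i.+1 (n - i.+1)]).

Lemma wt_cell (F : fieldType) (alpha beta gamma delta q : F) (n : nat) (T : filling n) :
  wt alpha beta gamma delta q T =
  \prod_(b : box n) cell_val alpha beta gamma delta q T (brow b) (bcol b).
Proof.
apply: eq_bigr => b _; rewrite /cell_val labE; case: (T b) => //.
by rewrite label_rightE label_belowE.
Qed.

Lemma cell_val_add_columnS (F : fieldType) (alpha beta gamma delta q : F) (n : nat)
    (s : seq (option label)) (T : filling n) i j : (i + j < n)%N ->
  cell_val alpha beta gamma delta q (add_column s T) i j.+1 =
  cell_val alpha beta gamma delta q T i j.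
Proof.
move=> hij; rewrite /cell_val lab_add_columnS; case: (lab T i j) => //.
congr empty_val.
  rewrite subSS -(addn1 j.+1) addnC iotaDl -map_comp.
  by under eq_map => k do rewrite /= add1n lab_add_columnS.
under eq_map => k do rewrite lab_add_columnS.
(* In the larger staircase the scan reaches one row further, to row [n]; there [T] has no box and
   [lab] gives [None]. *)
rewrite subSS (_ : n - i = (n - i.+1).+1)%N; last lia.
rewrite -[(n - i.+1).+1]addn1 iotaD map_cat cats1 lab_out ?first_label_rcons_None //; lia.
Qed.

Lemma cell_val_add_column0 (F : fieldType) (alpha beta gamma delta q : F) (n : nat)
    (s : n.+1.-tuple (option label)) (T : filling n) i :
  cell_val alpha beta gamma delta q (add_column s T) i 0 =
  if nth None s i is Some l then label_val alpha beta gamma delta l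
  else empty_val q (row_lab T i) (first_label (drop i.+1 s)).
Proof.
rewrite /cell_val lab_add_column0; case: (nth None s i) => //.
congr empty_val; last congr first_label.
  rewrite subn1 /= -[1%N]addn0 iotaDl -map_comp.
  by under eq_map => k do rewrite /= add1n lab_add_columnS.
under eq_map => k do rewrite lab_add_column0.
rewrite -[i.+1]addn0 iotaDl -map_comp /=.
apply: (@eq_from_nth _ None) => [|k].
  by rewrite size_map size_iota size_drop size_tuple addn0.
rewrite size_map size_iota => hk.
by rewrite (nth_map 0%N) ?size_iota // nth_iota // nth_drop /= addn0.
Qed.

Lemma wt_add_column (F : fieldType) (alpha beta gamma delta q : F) (n : nat)
    (s : n.+1.-tuple (option label)) (T : filling n) :
  wt alpha beta gamma delta q (add_column s T) =
  (\prod_(i < n.+1) if nth None s i is Some l then label_val alpha beta gamma delta l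
     else empty_val q (row_lab T i) (first_label (drop i.+1 s))) *
  wt alpha beta gamma delta q T.
Proof.
rewrite !wt_cell prod_box_recl; congr (_ * _).
  by apply: eq_bigr => i _; rewrite cell_val_add_column0.
by apply: eq_bigr => b _; rewrite cell_val_add_columnS ?box_lt.
Qed.

Definition bullet (o : option label) : bool :=
  (o == Some Alpha) || (o == Some Delta).

Lemma num_bulletsE (n : nat) (T : filling n) :
  num_bullets T = (\sum_(r < n) bullet (lab T r (n - r.+1)))%N.
Proof.
rewrite /num_bullets /tableau_type -sum1_count big_map big_enum_cond big_mkcond /=.
by apply: eq_bigr => r _; rewrite lab_diag -/(bullet _); case: bullet.
Qed.

(** The new column meets the diagonal in its bottom box only, and the old diagonal boxes stay on the
    diagonal. *)
Lemma num_bullets_add_column (n : nat) (s : n.+1.-tuple (option label)) (T : filling n) :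
  num_bullets (add_column s T) = (num_bullets T + bullet (nth None s n))%N.
Proof.
rewrite !num_bulletsE big_ord_recr /= subnn lab_add_column0; congr (_ + _)%N.
apply: eq_bigr => r _; rewrite subSS (_ : n - r = (n - r.+1).+1)%N ?lab_add_columnS //.
by have := ltn_ord r; lia.
Qed.

(** * Column sums *)

Section ColumnSums.

Variables (F : fieldType) (alpha beta gamma delta q y : F).

Definition row_wt (u : F) (o : option label) : {poly F} :=
  if is_ag o then 'X else if o == Some Delta then u%:P else 1.

Definition label_wt (u : F) (l : label) : {poly F} :=
  label_val alpha beta gamma delta l *: row_wt u (Some l).

(** The factor of a box in the new column times the marker of its row after the insertion: a label
    in the box becomes the leftmost label, an empty box leaves the former one in place. *)
Definition cell_wt (u : F) (right o below : option label) : {poly F} :=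
  if o is Some l then label_wt u l else empty_val q right below *: row_wt u right.

(** Inadmissible columns get weight 0, so that sums can run over all tuples. The power of [y] sits
    at the bottom box, the only diagonal one. *)
Fixpoint column_wt (u : F) (st s : seq (option label)) : {poly F} :=
  match st, s with
  | o' :: st', o :: s' =>
      (if (o == None) || is_ag o' && is_bd (first_label s')
       then cell_wt u o' o (first_label s') else 0) * column_wt u st' s'
  | [::], [:: Some l] => y ^+ bullet (Some l) *: label_wt u l
  | _, _ => 0
  end.

Lemma column_wtE (u : F) (st s : seq (option label)) : size s = (size st).+1 ->
  column_wt u st s = if column_ok st s then
    y ^+ bullet (nth None s (size st)) *: \prod_(i < (size st).+1)
      cell_wt u (nth None st i) (nth None s i) (first_label (drop i.+1 s))
  else 0.
Proof.
elim: st s => [|o' st IHst] [|o s] //= [].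
  by case: s => // _; case: o => //= l; rewrite big_ord1.
move=> hs; rewrite IHst // [in RHS]big_ord_recl /= drop0.
by case: ifP => //= _; case: ifP => //= _; rewrite ?mulr0 ?mul0r -?scalerAr.
Qed.

(* [u] counts the rows whose leftmost label is a delta: each of them
   contributes [q] to every further column. *)
Definition tableau_poly (n : nat) (u : F) : {poly F} :=
  \sum_(T : filling n | is_staircase_tableau T)
    (wt alpha beta gamma delta q T * y ^+ num_bullets T) *:
    \prod_(i < n) row_wt u (row_lab T i).

Lemma tableau_poly_horner1 (n : nat) :
  (tableau_poly n 1).[1] = Z n y alpha beta gamma delta q.
Proof.
rewrite horner_sum; apply: eq_bigr => T _; rewrite hornerZ horner_prod.
rewrite big1 ?mulr1 // => i _; rewrite /row_wt.
by case: ifP => _; [rewrite hornerX | case: ifP => _; rewrite hornerC].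
Qed.

Lemma tableau_polyS (n : nat) (u : F) :
  tableau_poly n.+1 u = \sum_(T : filling n | is_staircase_tableau T)
    (wt alpha beta gamma delta q T * y ^+ num_bullets T) *:
    \sum_(s : n.+1.-tuple (option label)) column_wt u (row_labs T) s.
Proof.
rewrite /tableau_poly big_mkcond sum_add_column [RHS]big_mkcond.
apply: eq_bigr => T _; case: ifP => vT; last first.
  by rewrite big1 // => s _; rewrite staircase_add_column vT.
rewrite scaler_sumr; apply: eq_bigr => s _.
rewrite staircase_add_column vT column_wtE ?size_row_labs ?size_tuple //=.
case: ifP => _; last by rewrite scaler0.
rewrite wt_add_column num_bullets_add_column scalerA exprD.
set P := \prod_(i < n.+1) (if _ is Some _ then _ else _).
rewrite (_ : \prod_(i < n.+1) cell_wt _ _ _ _ =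
  P *: \prod_(i < n.+1) row_wt u (row_lab (add_column s T) i)).
  rewrite scalerA; congr (_ *: _).
  move: P (wt _ _ _ _ _ T) (y ^+ num_bullets T) (y ^+ bullet _) => a b c d.
  by rewrite [a * b]mulrC -!mulrA; congr (b * _); rewrite mulrC -!mulrA.
rewrite -scaler_prod; apply: eq_bigr => i _.
by rewrite row_lab_add_column nth_row_labs /cell_wt; case: nth.
Qed.

(** Total weights, without the power of [y], of the columns with topmost label [l] beside [f] rows
    that all start with alpha or gamma: [dcol] for a bullet at the bottom, [ecol] for a circle. The
    recursion inspects the box just above the bottom one. If it is empty, it sees the bottom label
    and yields ['X] or [q *: 'X]; if it is labelled, the bottom label is delta or beta, and the
    labelled box serves as the bottom of a shorter column. *)
Fixpoint dcol (u : F) (f : nat) (l : label) : {poly F} :=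
  if f is f'.+1 then
    'X * dcol u f' l + label_wt u Delta * (dcol u f' l + ecol u f' l)
  else if bullet (Some l) then label_wt u l else 0
with ecol (u : F) (f : nat) (l : label) : {poly F} :=
  if f is f'.+1 then
    q *: 'X * ecol u f' l + label_wt u Beta * (dcol u f' l + ecol u f' l)
  else if bullet (Some l) then 0 else label_wt u l.

Lemma dcolS (u : F) (f : nat) (l : label) : dcol u f.+1 l =
  'X * dcol u f l + label_wt u Delta * (dcol u f l + ecol u f l).
Proof. by []. Qed.

Lemma ecolS (u : F) (f : nat) (l : label) : ecol u f.+1 l =
  q *: 'X * ecol u f l + label_wt u Beta * (dcol u f l + ecol u f l).
Proof. by []. Qed.

(** The same columns split at the top: the top box is empty or carries [l], and in the second case
    the next label is beta or delta. Splitting at the top commutes with splitting at the bottom,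
    hence the induction. Gamma to the right gives the same [e] as alpha. *)
Lemma decol_top (u : F) (f : nat) (l : label) :
  let e := empty_val q (Some Alpha) (Some l) in
  dcol u f.+1 l = e *: 'X * dcol u f l + label_wt u l * (dcol u f Beta + dcol u f Delta)
  /\ ecol u f.+1 l = e *: 'X * ecol u f l + label_wt u l * (ecol u f Beta + ecol u f Delta).
Proof.
move=> e; elim: f => [|f [IHd IHe]].
  by rewrite {}/e; case: l => /=; rewrite ?scale1r; split; ring.
by split; [rewrite [LHS]dcolS|rewrite [LHS]ecolS];
  rewrite [in LHS]IHd [in LHS]IHe !(dcolS, ecolS) -!mul_polyC; ring.
Qed.

Definition column_sum (u : F) (st : seq (option label)) (l : label) : {poly F} :=
  \sum_(s : (size st).+1.-tuple (option label) | first_label s == Some l)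
    column_wt u st s.

Lemma column_wt_first_None (u : F) (st s : seq (option label)) :
  first_label s = None -> column_wt u st s = 0.
Proof.
elim: st s => [|o' st IHst] [|[l|] s] //=.
by move=> h; rewrite IHst // mulr0.
Qed.

Lemma column_sum_total (u : F) (st : seq (option label)) :
  \sum_(s : (size st).+1.-tuple (option label)) column_wt u st s =
  \sum_l column_sum u st l.
Proof.
rewrite (exchange_big_dep xpredT) //=; apply: eq_bigr => s _.
case h: (first_label s) => [l|]; last by rewrite column_wt_first_None // big_pred0.
by rewrite (big_pred1 l) // => l'; rewrite eq_sym.
Qed.

Lemma column_sum_cons (u : F) (o : option label) (st : seq (option label)) (l : label) :
  column_sum u (o :: st) l =
  empty_val q o (Some l) *: row_wt u o * column_sum u st l +
  (if is_ag o then label_wt u l * (column_sum u st Beta + column_sum u st Delta) else 0).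
Proof.
rewrite /column_sum big_tcons sum_option /=; congr (_ + _).
  by rewrite big_distrr /=; apply: eq_bigr => s /eqP ->.
rewrite (bigD1 l) //= [X in _ + X]big1 ?addr0; last first.
  by move=> l' /negPf ne; rewrite big_pred0 // => s; apply/negP => /eqP [e]; rewrite e eqxx in ne.
rewrite (eq_bigl xpredT); last by move=> s; rewrite eqxx.
case: (is_ag o) => /=; last by rewrite big1 // => s _; rewrite mul0r.
rewrite mulrDr !mulr_sumr !(big_mkcond (fun s => _ == _)) -big_split /=.
apply: eq_bigr => s _; rewrite /is_bd.
by case: (first_label s) => [[]|]; rewrite /= ?mul0r ?addr0 ?add0r.
Qed.

(** A row starting with beta or delta forces an empty box, which leaves the labels seen by the other
    boxes unchanged; for delta it has weight [q] and marker [u]. Rows starting with alpha or gamma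
    follow [decol_top], so only their number matters. *)
Lemma column_sumE (u : F) (st : seq (option label)) (l : label) : None \notin st ->
  column_sum u st l = (q * u) ^+ count_mem (Some Delta) st *:
    (y *: dcol u (count is_ag st) l + ecol u (count is_ag st) l).
Proof.
elim: st l => [|o st IHst] l.
  move=> _; rewrite /column_sum big_tcons sum_option /= scale1r.
  rewrite big1 ?add0r => [|//].
  rewrite (bigD1 l) //= [X in _ + X]big1 ?addr0; last first.
    by move=> l' /negPf ne; rewrite big_pred0 // => s; apply/negP => /eqP [e]; rewrite e eqxx in ne.
  rewrite (big_pred1 [tuple]) /=; last by move=> s; rewrite [s]tuple0 !eqxx.
  by case: ifP => _; rewrite ?expr1 ?expr0 ?scale1r ?scaler0 ?addr0 ?add0r.
rewrite inE negb_or column_sum_cons => /andP[ho hst]; rewrite !IHst //.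
set k := count_mem _ st; set f := count _ st.
move: (decol_top u f l) => /= [hd he].
case: o ho => [[]|] //= _; rewrite -/k -/f !add0n ?hd ?he ?exprS /row_wt /= -!mul_polyC.
- ring.
- ring.
- ring.
- by rewrite !polyCM; ring.
Qed.

(** * The operators D and E on polynomials in x *)

Definition dtot (u : F) (f : nat) : {poly F} := \sum_l dcol u f l.

Definition etot (u : F) (f : nat) : {poly F} := \sum_l ecol u f l.

Lemma dtot0 (u : F) : dtot u 0 = alpha *: 'X + (delta * u)%:P.
Proof. by rewrite /dtot sum_label /= !addr0 /label_wt /row_wt /= -!mul_polyC polyCM. Qed.

Lemma etot0 (u : F) : etot u 0 = gamma *: 'X + beta%:P.
Proof.
by rewrite /etot sum_label /= add0r addr0 addrC /label_wt /row_wt /= -!mul_polyC mulr1.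
Qed.

Lemma dtotS (u : F) (f : nat) :
  dtot u f.+1 = 'X * dtot u f + (delta * u) *: (dtot u f + etot u f).
Proof.
rewrite {1}/dtot; under eq_bigr => l _ do rewrite dcolS.
rewrite big_split -mulr_sumr -mulr_sumr big_split -/(dtot u f) -/(etot u f).
by rewrite -mul_polyC /label_wt /row_wt -[_ *: u%:P]mul_polyC polyCM.
Qed.

Lemma etotS (u : F) (f : nat) :
  etot u f.+1 = q *: ('X * etot u f) + beta *: (dtot u f + etot u f).
Proof.
rewrite {1}/etot; under eq_bigr => l _ do rewrite ecolS.
rewrite big_split -mulr_sumr -mulr_sumr big_split -/(dtot u f) -/(etot u f).
by rewrite -scalerAl -[beta *: (_ + _)]mul_polyC /label_wt /row_wt -[_ *: 1]mul_polyC mulr1.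
Qed.

(** The linear map sending ['X^i] to [B i]. *)
Definition lincomb (B : nat -> {poly F}) (p : {poly F}) : {poly F} :=
  \sum_(i < size p) p`_i *: B i.

Lemma lincombE (B : nat -> {poly F}) (m : nat) (p : {poly F}) : (size p <= m)%N ->
  lincomb B p = \sum_(i < m) p`_i *: B i.
Proof.
move=> hm; rewrite /lincomb (big_ord_widen m (fun i => p`_i *: B i)) // big_mkcond.
apply: eq_bigr => i _; case: ltnP => // h.
by rewrite nth_default // scale0r.
Qed.

Lemma lincomb_linear (B : nat -> {poly F}) : linear (lincomb B).
Proof.
move=> c p r; pose m := maxn (size (c *: p + r)%R) (maxn (size p) (size r)).
have h1 : (size (c *: p + r)%R <= m)%N by rewrite leq_maxl.
have h2 : (size p <= m)%N by rewrite /m; lia.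
have h3 : (size r <= m)%N by rewrite /m; lia.
rewrite (lincombE B h1) (lincombE B h2) (lincombE B h3) scaler_sumr -big_split /=.
by apply: eq_bigr => i _; rewrite coefD coefZ scalerDl scalerA.
Qed.

HB.instance Definition _ (B : nat -> {poly F}) :=
  GRing.isLinear.Build F {poly F} {poly F} *:%R (lincomb B) (lincomb_linear B).

Lemma lincombXn (B : nat -> {poly F}) (f : nat) : lincomb B 'X^f = B f.
Proof.
rewrite (@lincombE _ f.+1) ?size_polyXn // big_ord_recr /= coefXn eqxx scale1r.
by rewrite big1 ?add0r // => i _; rewrite coefXn ltn_eqF ?scale0r.
Qed.

Lemma lincombMX (B : nat -> {poly F}) (p : {poly F}) :
  lincomb B ('X * p) = lincomb (B \o succn) p.
Proof.
have hs : (size ('X * p)%R <= (size p).+1)%N.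
  by have [->|h] := eqVneq p 0; [rewrite mulr0 size_poly0 | rewrite mulrC size_mulX].
rewrite (lincombE _ hs) big_ord_recl coefXM /= scale0r add0r.
by apply: eq_bigr => i _; rewrite coefXM.
Qed.

Definition dop (u : F) : {poly F} -> {poly F} := lincomb (dtot u).

Definition eop (u : F) : {poly F} -> {poly F} := lincomb (etot u).

HB.instance Definition _ (u : F) := GRing.Linear.copy (dop u) (lincomb (dtot u)).

HB.instance Definition _ (u : F) := GRing.Linear.copy (eop u) (lincomb (etot u)).

Lemma dop1 (u : F) : dop u 1 = alpha *: 'X + (delta * u)%:P.
Proof. by rewrite -[1](expr0 'X) /dop lincombXn dtot0. Qed.

Lemma eop1 (u : F) : eop u 1 = gamma *: 'X + beta%:P.
Proof. by rewrite -[1](expr0 'X) /eop lincombXn etot0. Qed.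

Lemma dopMX (u : F) (p : {poly F}) :
  dop u ('X * p) = 'X * dop u p + (delta * u) *: (dop u p + eop u p).
Proof.
rewrite /dop /eop lincombMX /lincomb mulr_sumr -big_split scaler_sumr -big_split /=.
by apply: eq_bigr => i _; rewrite dtotS -!mul_polyC; ring.
Qed.

Lemma eopMX (u : F) (p : {poly F}) :
  eop u ('X * p) = q *: ('X * eop u p) + beta *: (dop u p + eop u p).
Proof.
rewrite /dop /eop lincombMX /lincomb mulr_sumr -big_split !scaler_sumr -big_split /=.
by apply: eq_bigr => i _; rewrite etotS -!mul_polyC; ring.
Qed.

Lemma prod_row_wt (v : F) (st : seq (option label)) : None \notin st ->
  \prod_(o <- st) row_wt v o =
  v ^+ count_mem (Some Delta) st *: 'X^(count is_ag st).
Proof.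
elim: st => [|o st IHst]; first by rewrite big_nil scale1r.
rewrite inE negb_or big_cons => /andP[ho hst]; rewrite IHst //.
by case: o ho => [[]|] //= _; rewrite /row_wt /= ?mul1r // -!mul_polyC ?exprS ?polyCM; ring.
Qed.

(** With marker [q * u], the monomial of a tableau is the power of [q * u] occurring in
    [column_sumE] times ['X^f], where [f] is the number of rows starting with alpha or gamma; D and
    E turn ['X^f] into the column totals. *)
Lemma tableau_poly_rec (n : nat) (u : F) :
  tableau_poly n.+1 u = y *: dop u (tableau_poly n (q * u)) + eop u (tableau_poly n (q * u)).
Proof.
rewrite tableau_polyS [tableau_poly n _]/tableau_poly.
rewrite (linear_sum (dop u)) (linear_sum (eop u)) scaler_sumr -big_split /=.
apply: eq_bigr => T vT; rewrite !linearZ /=.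
have hN : None \notin row_labs T.
  apply/negP => /mapP[i]; rewrite mem_iota => /andP[_ hi] e.
  by have := row_lab_neqNone vT hi; rewrite -e.
have -> : \prod_(i < n) row_wt (q * u) (row_lab T i) = \prod_(o <- row_labs T) row_wt (q * u) o.
  by rewrite big_map -[X in iota 0 X]subn0 -/(index_iota 0 n) big_mkord.
rewrite prod_row_wt // !linearZ /= /dop /eop !lincombXn.
have := column_sum_total u (row_labs T); rewrite size_row_labs => ->.
under eq_bigr => l _ do rewrite column_sumE //.
rewrite -scaler_sumr big_split /= -scaler_sumr -/(dtot _ _) -/(etot _ _).
set A := (X in X *: _ = _); set B := (X in A *: (X *: _)).
by rewrite !scalerDr !scalerA [A * B]mulrC [_ * y]mulrC [y * (_ * _)]mulrA.
Qed.

Lemma tableau_poly0 (u : F) : tableau_poly 0 u = 1.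
Proof.
have box0 (b : box 0) : False by case: (brow b).
pose T0 : filling 0 := [ffun=> None].
rewrite /tableau_poly (big_pred1 T0) => [|T].
  rewrite /wt /num_bullets big1 => [|b]; last by case: (box0 b).
  by rewrite big_ord0 tuple0 mul1r scale1r.
have -> : T = T0 by apply/ffunP => b; case: (box0 b).
rewrite /= eqxx; apply/staircaseP; split=> // i j k; rewrite lab_out //.
Qed.

End ColumnSums.

(** * The bidiagonal basis *)

(** Reduces a polynomial identity with a common factor [p] to three identities in [F], where [field]
    applies. *)
Lemma quad_eq0 (F : fieldType) (p : {poly F}) (d2 d1 d0 : F) :
  d2 = 0 -> d1 = 0 -> d0 = 0 -> p * (d2%:P * 'X^2 + d1%:P * 'X + d0%:P) = 0.
Proof. by move=> -> -> ->; rewrite !mul0r !addr0 mulr0. Qed.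

Section Expansion.

Variables (F : fieldType) (alpha beta gamma delta q a c : F).

Definition psi_slope (i : nat) : F := alpha * (a * q ^+ i) * (1 - q).

Definition psi_const (i : nat) (u : F) : F :=
  alpha * (a * q ^+ i) *
  (delta * (1 + a * q ^+ i) * u - beta * (1 + (a * q ^+ i)^-1)).

Definition psi (k : nat) (u : F) : {poly F} :=
  \prod_(i < k) (psi_slope i *: 'X + (psi_const i u)%:P).

Lemma psiS (k : nat) (u : F) :
  psi k.+1 u = psi k u * (psi_slope k *: 'X + (psi_const k u)%:P).
Proof. exact: big_ord_recr. Qed.

Local Notation dop := (dop alpha beta gamma delta q).
Local Notation eop := (eop alpha beta gamma delta q).

Lemma dop_mul_linear (u s t : F) (p : {poly F}) :
  dop u (p * (s *: 'X + t%:P)) =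
  s *: ('X * dop u p + (delta * u) *: (dop u p + eop u p)) + t *: dop u p.
Proof.
rewrite mulrDr -scalerAr mulrC [p * _]mulrC mul_polyC.
by rewrite linearD !linearZ /= dopMX.
Qed.

Lemma eop_mul_linear (u s t : F) (p : {poly F}) :
  eop u (p * (s *: 'X + t%:P)) =
  s *: (q *: ('X * eop u p) + beta *: (dop u p + eop u p)) + t *: eop u p.
Proof.
rewrite mulrDr -scalerAr mulrC [p * _]mulrC mul_polyC.
by rewrite linearD !linearZ /= eopMX.
Qed.

(** Induction on [k]: the last linear factor of [psi k.+1 (q * u)] is moved out of D and E by
    [dopMX] and [eopMX]. By the induction hypothesis both sides are then [psi k u] times a quadratic
    in ['X], and the coefficients agree by the relations for [q] and [gamma]. *)
Lemma dop_eop_psi (k : nat) (u : F) :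
  1 - q = alpha * (1 + a) * (1 + c) -> gamma = - (alpha * a * c) ->
  a != 0 -> q != 0 ->
  let w := a * q ^+ k in
  let m := alpha * beta - gamma * delta * q ^+ k * u in
  (1 - q) *: dop u (psi k (q * u)) = ((1 + w^-1) * m) *: psi k u + w^-1 *: psi k.+1 u /\
  (1 - q) *: eop u (psi k (q * u)) = ((1 + w) * m) *: psi k u - c *: psi k.+1 u.
Proof.
move=> hq hg a0 q0; elim: k => [|k [IHd IHe]] w m.
  rewrite psiS /psi !big_ord0 mul1r dop1 eop1 /m /w /psi_slope.
  set t := psi_const 0 u; rewrite expr0 !mulr1.
  split; apply/eqP; rewrite -subr_eq0 -!mul_polyC; apply/eqP.
  - rewrite [LHS](_ : _ = 1 * (0%:P * 'X^2 +
      ((1 - q) * alpha - a^-1 * (alpha * a * (1 - q)))%:P * 'X +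
      ((1 - q) * (delta * u) - (1 + a^-1) * (alpha * beta - gamma * delta * u)
        - a^-1 * t)%:P)); last by ring.
    by apply: quad_eq0 => //; rewrite /t /psi_const ?expr0 ?mulr1 ?hg ?hq; field.
  - rewrite [LHS](_ : _ = 1 * (0%:P * 'X^2 +
      ((1 - q) * gamma + c * (alpha * a * (1 - q)))%:P * 'X +
      ((1 - q) * beta - (1 + a) * (alpha * beta - gamma * delta * u)
        + c * t)%:P)); last by ring.
    by apply: quad_eq0 => //; rewrite /t /psi_const ?expr0 ?mulr1 ?hg ?hq; field.
(* Solved for [q], the relation eliminates [q]; [q ^+ k] is generalized beforehand to an independent
   nonzero [Q]. *)
have hq' : q = 1 - alpha * (1 + a) * (1 + c) by rewrite -hq; ring.
have hQ : q ^+ k != 0 by rewrite expf_neq0.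
have e1 : (q ^+ k.+1 : F) = q * q ^+ k by rewrite exprS.
rewrite !(psiS k) psiS dop_mul_linear eop_mul_linear.
move: IHd IHe; rewrite psiS; set m0 := (_ - _ * q ^+ k * u); set w0 := a * q ^+ k.
set s := psi_slope k; set t := psi_const k u; set tq := psi_const k (q * u).
set s' := psi_slope k.+1; set t' := psi_const k.+1 u.
set p := psi k u; set A := dop u _; set B := eop u _ => IHd IHe.
split; apply/eqP; rewrite -subr_eq0; apply/eqP.
- rewrite [(1 - q) *: _](_ : _ = s *: ('X * ((1 - q) *: A) +
      (delta * u) *: ((1 - q) *: A + (1 - q) *: B)) + tq *: ((1 - q) *: A)); last first.
    by rewrite -!mul_polyC; ring.
  rewrite IHd IHe.
  set n0 := (1 + w0^-1) * m0; set n1 := (1 + w0) * m0; set n2 := (1 + w^-1) * m.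
  rewrite [LHS](_ : _ = p * ((s * w0^-1 * s - w^-1 * s * s')%:P * 'X^2 +
    (s * (n0 + w0^-1 * t) + s * (delta * u) * (w0^-1 * s - c * s) + tq * w0^-1 * s
      - n2 * s - w^-1 * (s * t' + t * s'))%:P * 'X +
    (s * (delta * u) * (n0 + w0^-1 * t + n1 - c * t) + tq * (n0 + w0^-1 * t)
      - n2 * t - w^-1 * t * t')%:P)); last by rewrite -!mul_polyC; ring.
  apply: quad_eq0; rewrite /n0 /n1 /n2 /w /m /m0 /w0 /s /s' /t /t' /tq
    /psi_slope /psi_const e1; move: (q ^+ k) hQ => Q hQ;
    rewrite ?hg hq'; field; by rewrite ?hQ ?a0 -?hq' ?q0.
- rewrite [(1 - q) *: _](_ : _ = s *: (q *: ('X * ((1 - q) *: B)) +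
      beta *: ((1 - q) *: A + (1 - q) *: B)) + tq *: ((1 - q) *: B)); last first.
    by rewrite -!mul_polyC; ring.
  rewrite IHd IHe.
  set n0 := (1 + w0^-1) * m0; set n1 := (1 + w0) * m0; set n2 := (1 + w) * m.
  rewrite [LHS](_ : _ = p * ((c * s * s' - s * q * c * s)%:P * 'X^2 +
    (s * q * (n1 - c * t) + s * beta * (w0^-1 * s - c * s) - tq * c * s
      - n2 * s + c * (s * t' + t * s'))%:P * 'X +
    (s * beta * (n0 + w0^-1 * t + n1 - c * t) + tq * (n1 - c * t)
      - n2 * t + c * t * t')%:P)); last by rewrite -!mul_polyC; ring.
  apply: quad_eq0; rewrite /n0 /n1 /n2 /w /m /m0 /w0 /s /s' /t /t' /tq
    /psi_slope /psi_const e1; move: (q ^+ k) hQ => Q hQ;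
    rewrite ?hg hq'; field; by rewrite ?hQ ?a0 -?hq' ?q0.
Qed.

End Expansion.

(** * Divided differences *)

Section DividedDifferences.

Variables (F : fieldType) (X : nat -> F).

(** The divided difference of the function x^n at the nodes [X 0], ..., [X k], in Lagrange form. *)
Definition divdiff (n k : nat) : F :=
  \sum_(j < k.+1) X j ^+ n / \prod_(i < k.+1 | i != j) (X j - X i).

(** Write X_j^(n+1) = X_(k+1) X_j^n + (X_j - X_(k+1)) X_j^n; the second term cancels the factor of
    the last node in the denominator. *)
Lemma divdiffS (N n k : nat) : (k < N)%N ->
  (forall i j, (i < j <= N)%N -> X j - X i != 0) ->
  divdiff n.+1 k.+1 = X k.+1 * divdiff n k.+1 + divdiff n k.
Proof.
move=> hk hX; rewrite /divdiff big_ord_recr [in X in _ = X + _]big_ord_recr /=.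
rewrite mulrDr exprS mulrA addrAC; congr (_ + _).
rewrite mulr_sumr -big_split /=; apply: eq_bigr => j _.
have hj : (j < k.+1)%N := ltn_ord j.
rewrite big_mkcond big_ord_recr /= -big_mkcond ifT; last by rewrite -val_eqE /= gtn_eqF.
set P := \prod_(i < k.+1 | i != j) _.
have h1 : X j - X k.+1 != 0 by rewrite -opprB oppr_eq0 hX //; lia.
have h2 : P != 0.
  apply/prodf_neq0 => i; rewrite -val_eqE /= => ne.
  have := ltn_ord i; case: (ltngtP i j) ne => // lt _ hi; first by rewrite hX //; lia.
  by rewrite -opprB oppr_eq0 hX //; lia.
rewrite exprS; field; by rewrite h1 h2.
Qed.

(** The Lagrange interpolation polynomial of the constant 1 at [k.+2] distinct nodes is 1 itself,
    and the divided difference is its coefficient of positive degree [k.+1]. *)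
Lemma divdiff_0S (N k : nat) : (k < N)%N ->
  (forall i j, (i < j <= N)%N -> X j - X i != 0) -> divdiff 0 k.+1 = 0.
Proof.
move=> hk hX.
pose l (j : 'I_k.+2) := \prod_(i < k.+2 | i != j) ('X - (X i)%:P).
pose d (j : 'I_k.+2) := \prod_(i < k.+2 | i != j) (X j - X i).
have hd j : d j != 0.
  apply/prodf_neq0 => i; rewrite -val_eqE /= => ne.
  have := ltn_ord i; have := ltn_ord j; case: (ltngtP i j) ne => // lt _ hi hj.
    by rewrite hX //; lia.
  by rewrite -opprB oppr_eq0 hX //; lia.
have sl j : size (l j) = k.+2.
  rewrite /l -big_filter size_prod_XsubC; congr S.
  by have [e _ _ [_ ->]] := big_enumP; rewrite cardC1 card_ord.
have ll j : (l j)`_k.+1 = 1.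
  have := monicP (monic_prod_XsubC (index_enum _) (fun i => i != j) (fun i : 'I_k.+2 => X i)).
  by rewrite /lead_coef -/(l j) sl.
pose p := \sum_j (d j)^-1 *: l j - 1.
have p0 : p = 0.
  apply: (@roots_geq_poly_eq0 _ _ [seq X i | i <- iota 0 k.+2]).
  - apply/allP => x /mapP[m]; rewrite mem_iota => /andP[_ hm] ->.
    rewrite /root hornerD hornerN hornerC horner_sum (bigD1 (Ordinal hm)) //=.
    rewrite big1 ?addr0 => [|j jm].
      rewrite hornerZ horner_prod [X in _ * X](_ : _ = d (Ordinal hm)).
        by rewrite mulVf ?subrr.
      by apply: eq_bigr => i _; rewrite hornerXsubC.
    rewrite hornerZ horner_prod (bigD1 (Ordinal hm)) 1?eq_sym //= hornerXsubC.
    by rewrite subrr mul0r mulr0.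
  - rewrite map_inj_in_uniq ?iota_uniq // => i j; rewrite !mem_iota => hi hj e.
    case: (ltngtP i j) => // lt.
      by have := hX i j; rewrite e subrr eqxx; lia.
    by have := hX j i; rewrite e subrr eqxx; lia.
  - rewrite size_map size_iota (leq_trans (size_polyD _ _)) // geq_max.
    rewrite size_polyN size_poly1 andbT; apply: (leq_trans (size_sum _ _ _)).
    by apply/bigmax_leqP => j _; rewrite (leq_trans (size_scale_leq _ _)) ?sl.
have : p`_k.+1 = 0 by rewrite p0 coef0.
rewrite coefB coef1 subr0 coef_sum => <-.
by apply: eq_bigr => j _; rewrite coefZ ll mulr1 expr0 mul1r.
Qed.

Lemma divdiff_n0 (n : nat) : divdiff n 0 = X 0%N ^+ n.
Proof. by rewrite /divdiff big_ord1 big_pred0 ?divr1 // => i; rewrite ord1. Qed.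

End DividedDifferences.

(** An entry of the n-th power of a bidiagonal matrix: the weighted count of paths from 0 to [k] in
    [n] steps, where staying at i has weight [X i] and moving from i to i+1 has weight [G i]. *)
Fixpoint path_sum (F : fieldType) (X G : nat -> F) (n k : nat) : F :=
  if n is n'.+1 then
    X k * path_sum X G n' k + (if k is k'.+1 then G k' * path_sum X G n' k' else 0)
  else (k == 0%N)%:R.

Lemma path_sum_gt (F : fieldType) (X G : nat -> F) (n k : nat) :
  (n < k)%N -> path_sum X G n k = 0.
Proof.
elim: n k => [|n IHn] [|k] //= h; rewrite !IHn ?mulr0 ?addr0 //; lia.
Qed.

(** Each path to [k] makes every move below [k] exactly once; the remaining sum over the stays obeys
    the recursion of the divided differences. *)
Lemma path_sumE (F : fieldType) (X G : nat -> F) (N n k : nat) : (k <= N)%N ->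
  (forall i j, (i < j <= N)%N -> X j - X i != 0) ->
  path_sum X G n k = (\prod_(i < k) G i) * divdiff X n k.
Proof.
move=> hk hX; elim: n k hk => [|n IHn] [|k] hk /=.
- by rewrite big_ord0 divdiff_n0 mulr1.
- by rewrite (divdiff_0S hk hX) mulr0.
- by rewrite IHn // addr0 big_ord0 !mul1r !divdiff_n0 exprS.
- rewrite !IHn ?(divdiffS n hk hX) ?(ltnW hk) // big_ord_recr /=; ring.
Qed.

(** By [dop_eop_psi], y D + E keeps the index k with weight [X k] times a factor [alpha * beta -
    gamma * delta * q ^+ k * u], or raises it with weight [G k]. *)
Lemma tableau_poly_psi (F : fieldType) (alpha beta gamma delta q y a c : F)
    (n : nat) (u : F) :
  1 - q = alpha * (1 + a) * (1 + c) -> gamma = - (alpha * a * c) ->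
  a != 0 -> q != 0 ->
  let X k := 1 + y + a * q ^+ k + y / (a * q ^+ k) in
  let G k := y / (a * q ^+ k) - c in
  (1 - q) ^+ n *: tableau_poly alpha beta gamma delta q y n u =
  \sum_(k < n.+1) (path_sum X G n k *
    \prod_(k <= i < n) (alpha * beta - gamma * delta * q ^+ i * u)) *:
    psi alpha beta delta q a k u.
Proof.
move=> hq hg a0 q0 X G; elim: n u => [|n IHn] u.
  by rewrite big_ord1 tableau_poly0 /psi big_ord0 big_geq //= mulr1.
rewrite tableau_poly_rec exprS.
set T := tableau_poly _ _ _ _ _ _ _ _.
have -> : ((1 - q) * (1 - q) ^+ n) *:
    (y *: dop alpha beta gamma delta q u T + eop alpha beta gamma delta q u T) =
  y *: ((1 - q) *: dop alpha beta gamma delta q u ((1 - q) ^+ n *: T)) +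
  (1 - q) *: eop alpha beta gamma delta q u ((1 - q) ^+ n *: T).
  rewrite !linearZ /= -!mul_polyC; ring.
rewrite {}/T IHn (linear_sum (dop alpha beta gamma delta q u)).
rewrite (linear_sum (eop alpha beta gamma delta q u)) !scaler_sumr -big_split /=.
pose L i := alpha * beta - gamma * delta * q ^+ i * u.
pose P k := psi alpha beta delta q a k u.
rewrite (eq_bigr (fun k : 'I_n.+1 =>
  (X k * path_sum X G n k * \prod_(k <= i < n.+1) L i) *: P k +
  (G k * path_sum X G n k * \prod_(k.+1 <= i < n.+1) L i) *: P k.+1)); last first.
  move=> k _; rewrite !linearZ /=.
  have [hd he] := dop_eop_psi beta delta k u hq hg a0 q0.
  (* Passing from [u] to [q * u] shifts the indices by one. A stay at [k] then supplies the missing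
     [L k], while a move to [k.+1] needs exactly the shifted product. *)
  have -> : \prod_(k <= i < n) (alpha * beta - gamma * delta * q ^+ i * (q * u)) =
      \prod_(k.+1 <= i < n.+1) L i.
    by rewrite big_add1; apply: eq_bigr => i _; rewrite /L exprS; ring.
  rewrite (@big_ltn _ _ _ k) ?ltn_ord //.
  move: (\prod_(k.+1 <= i < _) _) (path_sum _ _ _ _) => R S.
  move: hd he; rewrite -/(L k) -/(P k) -/(P k.+1) /X /G.
  move: (dop _ _ _ _ _ _ _) (eop _ _ _ _ _ _ _) (P k) (P k.+1) (L k) => D E p p' m hd he.
  rewrite [LHS](_ : _ = (S * R) *: (y *: ((1 - q) *: D) + (1 - q) *: E)).
    by rewrite hd he -!mul_polyC; ring.
  by rewrite -!mul_polyC; ring.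
rewrite big_split /=.
under [RHS]eq_bigr => k _ do rewrite mulrDl scalerDl.
rewrite big_split /=; congr (_ + _).
  by rewrite [RHS]big_ord_recr /= path_sum_gt // mulr0 mul0r scale0r addr0.
by rewrite [RHS]big_ord_recl /= mul0r scale0r add0r.
Qed.

(** Since 1 - q + delta = beta (1 + b + d), the factor with Q = a q^i becomes - alpha beta (1 - b Q)
    (1 - d Q) at x = u = 1. *)
Lemma psi_horner1 (F : fieldType) (alpha beta delta q a b d : F) (k : nat) :
  1 - q = beta * (1 + b) * (1 + d) -> delta = - (beta * b * d) ->
  a != 0 -> q != 0 ->
  (psi alpha beta delta q a k 1).[1] =
  (- (alpha * beta)) ^+ k * qpoch (a * b) q k * qpoch (a * d) q k.
Proof.
move=> hq hd a0 q0; rewrite -[k in _ ^+ k]card_ord -prodr_const -!big_split /=.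
rewrite horner_prod; apply: eq_bigr => i _.
rewrite hornerD hornerZ hornerX hornerC /psi_slope /psi_const hq hd.
have : q ^+ i != 0 by rewrite expf_neq0.
by move: (q ^+ i) => Q Q0; field; rewrite a0 Q0.
Qed.

(** * Differences of the nodes as q-Pochhammer products *)

Section Nodes.

Variables (F : fieldType) (q y a : F).
Hypotheses (q0 : q != 0) (y0 : y != 0) (a0 : a != 0).

Definition node (k : nat) : F := 1 + y + a * q ^+ k + y / (a * q ^+ k).

(** Factorwise X_j - X_i = - a q^i (1 - q^(j-i)) (1 - q^(-i-j) y / a^2); the Pochhammer factors
    appear in reverse order of i. *)
Lemma prod_node_lt (j : nat) :
  \prod_(i < j) (node j - node i) = (\prod_(i < j) - (a * q ^+ i)) *
    (qpoch q q j * qpoch (q ^ (- (2 * j)%:Z + 1) * y / a ^+ 2) q j).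
Proof.
rewrite /qpoch (reindex_inj rev_ord_inj) [X in _ = X * _](reindex_inj rev_ord_inj).
rewrite -!big_split /=; apply: eq_bigr => m _; have hm := ltn_ord m.
rewrite expfzDr // -exprnN expr1z /node.
have -> : (2 * j = (j - m.+1) + m + (j - m.+1) + m + 2)%N by lia.
have -> : q ^+ j = q ^+ (j - m.+1) * q ^+ m * q.
  by rewrite -exprD -exprSr; congr (_ ^+ _); lia.
rewrite !exprD.
have : q ^+ (j - m.+1) != 0 by rewrite expf_neq0.
have : q ^+ m != 0 by rewrite expf_neq0.
by move: (q ^+ m) (q ^+ (j - m.+1)) => M J M0 J0; field; rewrite a0 q0 M0 J0.
Qed.

(** For i > j the same difference is written - (y / (a q^i)) (1 - q^(i-j)) (1 - a^2 q^(i+j) / y),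
    here with i = j + 1 + m. *)
Lemma prod_node_gt (j l : nat) :
  \prod_(m < l) (node j - node (j.+1 + m)) = (\prod_(m < l) - (y / (a * q ^+ (j.+1 + m)))) *
    (qpoch q q l * qpoch (a ^+ 2 * q ^+ (1 + 2 * j) / y) q l).
Proof.
rewrite /qpoch -!big_split /=; apply: eq_bigr => m _.
rewrite /node (_ : 1 + 2 * j = (j + j).+1)%N; last lia.
rewrite addSn !exprS !exprD.
have : q ^+ m != 0 by rewrite expf_neq0.
have : q ^+ j != 0 by rewrite expf_neq0.
by move: (q ^+ m) (q ^+ j) => M J M0 J0; field; rewrite a0 q0 y0 M0 J0.
Qed.

Lemma prod_ord_split (j k : nat) (g : nat -> F) : (j <= k)%N ->
  \prod_(i < k.+1 | i != j :> nat) g i =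
  (\prod_(i < j) g i) * \prod_(m < k - j) g (j.+1 + m)%N.
Proof.
move=> hjk; rewrite -(big_mkord (fun i => i != j) g) (big_cat_nat (n := j)) //=; last lia.
congr (_ * _).
  rewrite big_mkord; apply: eq_bigl => i; have := ltn_ord i; lia.
rewrite big_ltn_cond ?eqxx /=; last lia.
rewrite -[j.+1 in X in X = _]add0n big_addn subSS big_mkord.
by apply: eq_big => [i|i _]; [lia | rewrite addnC].
Qed.

(** Term by term in j: with g_i = - y / (a q^i), the monomials split off from the denominators
    combine with g_0 ... g_(k-1) to g_j / g_k times the product of y / (a^2 q^(2i)) over i < j,
    which is q^k q^(-j^2) (a^2 / y)^(-j). *)
Lemma divdiff_node (n k : nat) :
  (forall j, (j <= k)%N ->
     qpochs [:: q; q ^ (- (2 * j)%:Z + 1) * y / a ^+ 2] q j != 0 /\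
     qpochs [:: q; a ^+ 2 * q ^+ (1 + 2 * j) / y] q (k - j) != 0) ->
  (\prod_(i < k) - (y / (a * q ^+ i))) * divdiff node n k =
  q ^+ k * \sum_(0 <= j < k.+1)
       (q ^ (- (j ^ 2)%N%:Z) * (a ^+ 2 / y) ^ (- j%:Z) *
        ((1 + y + q ^+ j * a + q ^ (- j%:Z) * y / a) ^+ n
         / (qpochs [:: q; q ^ (- (2 * j)%:Z + 1) * y / a ^+ 2] q j *
            qpochs [:: q; a ^+ 2 * q ^+ (1 + 2 * j) / y] q (k - j)))).
Proof.
move=> hne; rewrite /divdiff big_mkord !mulr_sumr; apply: eq_bigr => j _.
have hj : (j <= k)%N by rewrite -ltnS.
have [] := hne j hj.
rewrite /qpochs !big_cons !big_nil !mulr1 => h1 h2.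
rewrite (prod_ord_split (fun i => node j - node i) hj) prod_node_lt prod_node_gt.
have -> : 1 + y + q ^+ j * a + q ^ (- j%:Z) * y / a = node j.
  rewrite /node -exprnN [q ^+ j * a]mulrC; congr (_ + _).
  have : q ^+ j != 0 by rewrite expf_neq0.
  by move: (q ^+ j) => Q Q0; field; rewrite a0 Q0.
move: h1 h2; set A := qpoch q q j * _; set B := qpoch q q _ * _ => A0 B0.
set M := \prod_(i < j) _; set S := \prod_(m < k - j) _.
pose g i := - (y / (a * q ^+ i)).
have g0 i : g i != 0 by rewrite /g oppr_eq0 !mulf_neq0 ?invr_eq0 ?mulf_neq0 ?expf_neq0.
have M0 : M != 0 by apply/prodf_neq0 => i _; rewrite oppr_eq0 mulf_neq0 ?expf_neq0.
have S0 : S != 0 by apply/prodf_neq0 => i _; apply: g0.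
(* The extra factor [g k] completes the range to i <= k, which splits at [j] as the denominators
   do. *)
have e1 : (\prod_(i < k) g i) * g k = (\prod_(i < j) g i) * g j * S.
  transitivity (\prod_(i < k.+1) g i); first by rewrite big_ord_recr.
  by rewrite (bigD1 j) //= (prod_ord_split g hj) mulrCA mulrA.
have e0 : (\prod_(i < j) g i) * (q ^+ (j ^ 2) * (a ^+ 2 / y) ^+ j) = M * q ^+ j.
  rewrite /M; elim: (nat_of_ord j) => [|j' IHj]; first by rewrite exp0n // !big_ord0 !expr0 !mulr1.
  rewrite (_ : j'.+1 ^ 2 = j' ^ 2 + j' + j' + 1)%N; last lia.
  rewrite !big_ord_recr /= !exprD expr1 (exprS _ j') (exprS q j').
  have Q0 : q ^+ j' != 0 by rewrite expf_neq0.
  rewrite [LHS](_ : _ = (\prod_(i < j') g i) * (q ^+ (j' ^ 2) * (a ^+ 2 / y) ^+ j')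
    * (- (a * q ^+ j') * q)).
    by rewrite IHj; ring.
  rewrite /g; move: (\prod_(i < j') _) (q ^+ (j' ^ 2)) (_ ^+ j') (q ^+ j') Q0 => A1 A2 A3 Q Q0.
  by field; rewrite a0 y0 Q0.
have e2 : \prod_(i < j) g i * g j =
    M * g k * (q ^+ k * (q ^ (- (j ^ 2)%N%:Z) * (a ^+ 2 / y) ^ (- j%:Z))).
  rewrite -!exprnN; set Q1 := q ^+ (j ^ 2) in e0 *; set Q2 := (a ^+ 2 / y) ^+ j in e0 *.
  have Q1n : Q1 != 0 by rewrite expf_neq0.
  have Q2n : Q2 != 0 by rewrite expf_neq0 ?mulf_neq0 ?invr_eq0 ?expf_neq0.
  have -> : \prod_(i < j) g i = M * q ^+ j / (Q1 * Q2) by rewrite -e0 mulfK ?mulf_neq0.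
  have Qj : q ^+ j != 0 by rewrite expf_neq0.
  have Qk : q ^+ k != 0 by rewrite expf_neq0.
  rewrite /g; clear e0.
  move: (q ^+ j) (q ^+ k) Q1 Q2 M Qj Qk Q1n Q2n M0 => ? ? ? ? ? h3 h4 h5 h6 h7.
  by field; rewrite a0 h3 h4 h5 h6.
have e3 : \prod_(i < k) g i = M * S * (q ^+ k * (q ^ (- (j ^ 2)%N%:Z) * (a ^+ 2 / y) ^ (- j%:Z))).
  apply: (mulIf (g0 k)); rewrite e1 e2; ring.
rewrite -/(g _) e3; field; by rewrite ?A0 ?B0 ?M0 ?S0.
Qed.

End Nodes.

(* [a] and [c] are the two roots of [alpha X^2 - (1 - q - alpha + gamma) X - gamma]. *)
Lemma quadratic_roots (F : fieldType) (alpha gamma q s : F) :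
  2 != 0 :> F -> alpha != 0 ->
  s ^+ 2 = (1 - q - alpha + gamma) ^+ 2 + 4 * alpha * gamma ->
  let a := (1 - q - alpha + gamma + s) / (2 * alpha) in
  let c := (1 - q - alpha + gamma - s) / (2 * alpha) in
  1 - q = alpha * (1 + a) * (1 + c) /\ gamma = - (alpha * a * c).
Proof.
move=> h2 ha hs a c.
have h4 : 4 != 0 :> F by rewrite (_ : 4 = 2 * 2) ?mulf_neq0 //; ring.
have hac : alpha * a * c = - gamma.
  have -> : alpha * a * c = ((1 - q - alpha + gamma) ^+ 2 - s ^+ 2) / (4 * alpha).
    by rewrite /a /c; field; rewrite h2 h4 ha.
  by rewrite hs; field; rewrite ha h4.
split; last by rewrite hac opprK.
have -> : alpha * (1 + a) * (1 + c) = alpha + alpha * (a + c) + alpha * a * c by ring.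
by rewrite hac /a /c; field; rewrite h2 ha.
Qed.

(** * Evaluation at x = u = 1 and comparison with the double sum *)

Theorem theorem1p13 (F : fieldType) (char0 : [pchar F] =i pred0)
    (alpha beta gamma delta q y : F)
    (* the two square roots occurring in a, c and in b, d *)
    (sac sbd : F)
    (hsac : sac ^+ 2 = (1 - q - alpha + gamma) ^+ 2 + 4 * alpha * gamma)
    (hsbd : sbd ^+ 2 = (1 - q - beta + delta) ^+ 2 + 4 * beta * delta)
    (n : nat) :
  let a := (1 - q - alpha + gamma + sac) / (2 * alpha) in
  let b := (1 - q - beta + delta + sbd) / (2 * beta) in
  let c := (1 - q - alpha + gamma - sac) / (2 * alpha) in
  let d := (1 - q - beta + delta - sbd) / (2 * beta) in
  (* no denominator of the formula vanishes *)
  alpha != 0 -> beta != 0 -> q != 0 -> q != 1 -> y != 0 -> a != 0 ->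
  (forall k : nat, (k <= n)%N -> qpoch (a * b * c * d) q k != 0) ->
  (forall j k : nat, (j <= k <= n)%N ->
     qpochs [:: q; q ^ (- (2 * j)%:Z + 1) * y / a ^+ 2] q j != 0 /\
     qpochs [:: q; a ^+ 2 * q ^+ (1 + 2 * j) / y] q (k - j) != 0) ->
  Z n y alpha beta gamma delta q =
  qpoch (a * b * c * d) q n * (alpha * beta / (1 - q)) ^+ n *
  \sum_(0 <= k < n.+1)
    (qpochs [:: a * b; a * c / y; a * d] q k / qpoch (a * b * c * d) q k
     * q ^+ k *
     \sum_(0 <= j < k.+1)
       (q ^ (- (j ^ 2)%N%:Z) * (a ^+ 2 / y) ^ (- j%:Z) *
        ((1 + y + q ^+ j * a + q ^ (- j%:Z) * y / a) ^+ n
         / (qpochs [:: q; q ^ (- (2 * j)%:Z + 1) * y / a ^+ 2] q j *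
            qpochs [:: q; a ^+ 2 * q ^+ (1 + 2 * j) / y] q (k - j))))).
Proof.
move=> a b c d ha hb q0 q1 y0 a0 habcd hden.
have h2 : 2 != 0 :> F by rewrite ((pcharf0P F).1 char0 2).
have [hqa hg] := quadratic_roots h2 ha hsac.
have [hqb hd] := quadratic_roots h2 hb hsbd.
rewrite -/a -/c in hqa hg; rewrite -/b -/d in hqb hd.
(* From here on [a], [b], [c], [d] enter through the four relations just obtained. *)
clearbody a b c d.
have hq1 : 1 - q != 0 by rewrite subr_eq0 eq_sym.
(* The nodes are distinct: each difference is a factor of [prod_node_lt], whose Pochhammer part is a
   nonzero denominator of the formula. *)
have hX i j : (i < j <= n)%N -> node q y a j - node q y a i != 0.
  move=> /andP[hij hjn]; have [] := hden j j; first by rewrite leqnn.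
  rewrite /qpochs !big_cons !big_nil !mulr1 => h _.
  have : \prod_(i < j) (node q y a j - node q y a i) != 0.
    rewrite (prod_node_lt q0 y0 a0) mulf_neq0 //; apply/prodf_neq0 => m _.
    by rewrite oppr_eq0 mulf_neq0 ?expf_neq0.
  by move/prodf_neq0 => /(_ (Ordinal hij) isT).
have := congr1 (fun p => p.[1]) (tableau_poly_psi beta delta y n 1 hqa hg a0 q0).
rewrite hornerZ tableau_poly_horner1 horner_sum => E.
apply: (mulfI (expf_neq0 n hq1)); rewrite {}E -/(node q y a).
set R := qpoch _ q n.
rewrite expr_div_n [RHS](_ : _ = R * (alpha * beta) ^+ n *
  \sum_(0 <= k < n.+1)
    (qpochs [:: a * b; a * c / y; a * d] q k / qpoch (a * b * c * d) q k
     * q ^+ k *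
     \sum_(0 <= j < k.+1)
       (q ^ (- (j ^ 2)%N%:Z) * (a ^+ 2 / y) ^ (- j%:Z) *
        ((1 + y + q ^+ j * a + q ^ (- j%:Z) * y / a) ^+ n
         / (qpochs [:: q; q ^ (- (2 * j)%:Z + 1) * y / a ^+ 2] q j *
            qpochs [:: q; a ^+ 2 * q ^+ (1 + 2 * j) / y] q (k - j))))));
  last first.
  by move: (\sum_(0 <= k < n.+1) _) ((1 - q) ^+ n) (expf_neq0 n hq1) => S Q Q0; field.
rewrite [in RHS]big_mkord mulr_sumr; apply: eq_bigr => k _.
have hk : (k <= n)%N by rewrite -ltnS.
rewrite -[_ * q ^+ k * _]mulrA -(divdiff_node q0 y0 a0); last first.
  by move=> j hj; apply: hden; rewrite hj hk.
rewrite hornerZ (psi_horner1 _ _ hqb hd a0 q0) (path_sumE _ n hk hX).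
have hK : qpoch (a * b * c * d) q k != 0 by apply: habcd.
(* Splitting (abcd; q)_n at [k] cancels the denominator (abcd; q)_k. *)
have -> : R = qpoch (a * b * c * d) q k * \prod_(k <= i < n) (1 - a * b * c * d * q ^+ i).
  by rewrite /R /qpoch -!(big_mkord xpredT (fun i => 1 - _ * q ^+ i)) (big_cat_nat (n := k)).
(* Here gamma delta = alpha beta abcd. *)
have -> : \prod_(k <= i < n) (alpha * beta - gamma * delta * q ^+ i * 1) =
  (alpha * beta) ^+ (n - k) * \prod_(k <= i < n) (1 - a * b * c * d * q ^+ i).
  rewrite -prodr_const_nat -big_split /=; apply: eq_bigr => i _.
  by rewrite hg hd; ring.
(* The off-diagonal weights supply (ac/y; q)_k and the prefactor absorbed by [divdiff_node]. *)
have -> : \prod_(i < k) (y / (a * q ^+ i) - c) =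
   (-1) ^+ k * qpoch (a * c / y) q k * \prod_(i < k) - (y / (a * q ^+ i)).
  rewrite -[k in _ ^+ k]card_ord -prodr_const -!big_split /=; apply: eq_bigr => i _.
  have : q ^+ i != 0 by rewrite expf_neq0.
  by move: (q ^+ i) => Q Q0; field; rewrite a0 Q0 y0.
rewrite /qpochs !big_cons !big_nil !mulr1.
have -> : (alpha * beta) ^+ n = (alpha * beta) ^+ (n - k) * (alpha * beta) ^+ k.
  by rewrite -exprD subnK.
rewrite [(- (alpha * beta)) ^+ k]exprNn.
(* The sign from [psi_horner1] cancels the one from the off-diagonal weights. *)
have s1 : (-1) ^+ k * (-1) ^+ k = 1 :> F by rewrite -expr2 sqrr_sign.
move: (\prod_(i < k) _) (divdiff _ _ _) (\prod_(k <= i < n) _) => A1 A2 A3.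
move: (qpoch (a * b * c * d) q k) hK (qpoch (a * b) q k) (qpoch (a * c / y) q k)
  (qpoch (a * d) q k) ((alpha * beta) ^+ (n - k)) ((alpha * beta) ^+ k)
  ((-1) ^+ k) s1 => B B0 C1 C2 C3 D1 D2 e he.
rewrite [LHS](_ : _ = (e * e) * (C1 * C2 * C3 * A1 * A2 * A3 * D1 * D2)); last by ring.
by rewrite he; field.
Qed.
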